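(* Let $X$ be a measurable space, $\mathcal{H}$ a complex separable Hilbert space, and let $\mu:\mathcal{O}(X)\to\mathcal{B}(\mathcal{H})$ be a commutative normalized POVM, i.e. $\mu(A)\mu(B)=\mu(B)\mu(A)$ for all $A,B\in\mathcal{O}(X)$. Then $\mu$ is $C^*$-extreme in $\mathcal{P}_{\mathcal{H}}(X)$ if and only if $\mu$ is a spectral measure.
   Context: A measurable space is a nonempty set $X$ with a $\sigma$-algebra $\mathcal{O}(X)$ of subsets; all singletons are assumed measurable. $\mathcal{B}(\mathcal{H})$ denotes the bounded operators on $\mathcal{H}$; the inner product is linear in the second variable; a projection is a self-adjoint idempotent. A positive operator valued measure (POVM) on $X$ with values in $\mathcal{B}(\mathcal{H})$ is a map $\mu:\mathcal{O}(X)\to\mathcal{B}(\mathcal{H})$ with $\mu(A)\ge 0$ for all $A$ and such that for all $h,k\in\mathcal{H}$ the map $A\mapsto\langle h,\mu(A)k\rangle$ is a complex measure. It is normalized if $\mu(X)=I_{\mathcal{H}}$, and it is a spectral measure if it is normalized and every $\mu(A)$ is a projection. $\mathcal{P}_{\mathcal{H}}(X)$ is the set of all normalized POVMs on $X$ with values in $\mathcal{B}(\mathcal{H})$. A normalized POVM $\mu$ is a $C^*$-extreme point in $\mathcal{P}_{\mathcal{H}}(X)$ if, whenever $\mu(\cdot)=\sum_{i=1}^n T_i^*\mu_i(\cdot)T_i$ with $\mu_i\in\mathcal{P}_{\mathcal{H}}(X)$ and invertible $T_i\in\mathcal{B}(\mathcal{H})$ satisfying $\sum_{i=1}^n T_i^*T_i=I_{\mathcal{H}}$,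 there are unitaries $U_i\in\mathcal{B}(\mathcal{H})$ such that $\mu_i(\cdot)=U_i^*\mu(\cdot)U_i$ for $1\le i\le n$. *)

(* Defs.v *)
From HB Require Import structures.
From mathcomp Require Import all_boot all_order all_algebra sesquilinear.
From mathcomp Require Import complex.
From mathcomp Require Import all_classical all_reals all_analysis.

Set Implicit Arguments.
Unset Strict Implicit.
Unset Printing Implicit Defensive.

Import Order.TTheory GRing.Theory Num.Theory.
Import numFieldNormedType.Exports.

Local Open Scope classical_set_scope.
Local Open Scope ring_scope.
Local Open Scope complex_scope.

HB.mixin Record CompleteNormedModule_isHilbert (R : realType) H
    & CompleteNormedModule R[i] H := {
  hilbert_form : {dot H for (@Num.conj R[i])} ;
  hilbert_normE : forall x : H, `|x| ^+ 2 = hilbert_form x x }.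

#[short(type="hilbertType")]
HB.structure Definition Hilbert (R : realType) :=
  {H of CompleteNormedModule R[i] H & CompleteNormedModule_isHilbert R H}.

(* The forms of sesquilinear.v are linear in the first variable; swapping the
   arguments gives an inner product that is linear in the second one. *)
Definition inner (R : realType) (H : hilbertType R) (h k : H) : R[i] :=
  hilbert_form k h.

Definition separable (T : topologicalType) : Prop :=
  exists D : set T, countable D /\ dense D.

Section operators.
Context {R : realType} {H : hilbertType R}.
Implicit Types T U P : H -> H.

Definition bounded_op T : Prop :=
  linear T /\ exists M : R[i], forall h, `|T h| <= M * `|h|.

(* Every bounded operator has a unique bounded adjoint (Riesz), so the default
   value of xget is never reached when T is bounded. *)
Definition adjoint T : H -> H :=
  xget (cst 0)
    [set S | bounded_op S /\ forall h k, inner h (T k) = inner (S h) k].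

Definition invertible_op T : Prop :=
  exists S, [/\ bounded_op S, S \o T = idfun & T \o S = idfun].

Definition unitary_op U : Prop :=
  [/\ bounded_op U, adjoint U \o U = idfun & U \o adjoint U = idfun].

(* [0 <= z] in R[i] means that z is real and nonnegative. *)
Definition positive_op T : Prop := forall h, 0 <= inner h (T h).

Definition projection_op P : Prop :=
  [/\ bounded_op P, adjoint P = P & P \o P = P].

End operators.

(* nu set0 = 0 follows by taking every F i empty; R[i]^o carries the topology of
   the modulus. *)
Definition complex_measure (R : realType) (d : measure_display)
    (X : measurableType d) (nu : set X -> R[i]) : Prop :=
  forall F : (set X)^nat, (forall i, measurable (F i)) -> trivIset setT F ->
    (fun n => \sum_(0 <= i < n) nu (F i) : R[i]^o) @ \oo
      --> (nu (\bigcup_i F i) : R[i]^o).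

(* A set function is given on all of [set X], but only its values on measurable
   sets are ever constrained or compared. *)
Section povm.
Context {R : realType} {d : measure_display}.
Context {X : measurableType d} {H : hilbertType R}.
Implicit Types mu : set X -> H -> H.

Definition povm mu : Prop :=
  [/\ forall A, measurable A -> bounded_op (mu A),
      forall A, measurable A -> positive_op (mu A)
    & forall h k, complex_measure (fun A => inner h (mu A k))].

Definition normalized_povm mu : Prop := povm mu /\ mu setT = idfun.

Definition spectral_measure mu : Prop :=
  normalized_povm mu /\ forall A, measurable A -> projection_op (mu A).

Definition commutative_povm mu : Prop :=
  forall A B, measurable A -> measurable B -> mu A \o mu B = mu B \o mu A.

Definition Cstar_extreme mu : Prop :=
  normalized_povm mu /\
  forall (n : nat) (nu : 'I_n -> set X -> H -> H) (T : 'I_n -> H -> H),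
    (forall i, normalized_povm (nu i)) ->
    (forall i, bounded_op (T i) /\ invertible_op (T i)) ->
    \sum_(i < n) (adjoint (T i) \o T i) = idfun ->
    (forall A, measurable A ->
      mu A = \sum_(i < n) (adjoint (T i) \o nu i A \o T i)) ->
    exists U : 'I_n -> H -> H, forall i,
      unitary_op (U i) /\
      forall A, measurable A -> nu i A = adjoint (U i) \o mu A \o U i.

End povm.

(* Main.v *)
Require Import Defs.
From mathcomp Require Import all_boot all_order all_algebra sesquilinear.
From mathcomp Require Import complex.
From mathcomp Require Import all_classical all_reals all_analysis.
From mathcomp Require Import ring lra.

Set Implicit Arguments.
Unset Strict Implicit.
Unset Printing Implicit Defensive.

Import Order.TTheory GRing.Theory Num.Theory.
Import numFieldNormedType.Exports.

Local Open Scope classical_set_scope.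
Local Open Scope ring_scope.
Local Open Scope complex_scope.

(** The two implications rest on different ideas.

    Spectral measures are C*-extreme. Let mu be the sum of the T_i* nu_i T_i.
    A vector in the kernel of the projection mu(E) is, by positivity, sent by T_i
    into the kernel of nu_i(E). Used for E and for its complement, this gives the
    intertwining relation nu_i(E) T_i = T_i mu(E) ([spectral_intertwine]). Then
    T_i* T_i, and with it |T_i|, commutes with mu, and |T_i| T_i^-1 is a unitary
    that carries nu_i to mu ([intertwine_unitary]).

    A commutative C*-extreme measure is spectral. If L and M are positive
    operators commuting with mu, then mu is the C*-convex combination of its
    normalized reweightings by (a L on A, a M on the complement of A) and by
    (1 - a L, 1 - a M), for small a. C*-extremality makes the first one unitarily
    equivalent to mu, so that every eigenvalue of (L B + M (1 - B))^-1 L B is an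
    eigenvalue of B = mu(A) ([Cstar_extreme_eigenvalue]). If B is not a
    projection, L and M can be chosen as functions of B for which the quotient
    (L B + M (1 - B))^-1 L B takes a prescribed constant value y on a nonzero
    spectral piece of B, for any y strictly between 0 and 1
    ([Cstar_extreme_all_eigenvalues]). The self-adjoint operator B would then
    have uncountably many eigenvalues, which is impossible on a separable space
    ([separable_eigenvalues]).

    The operator theory behind both parts is elementary. Adjoints and inverses
    of coercive operators come from minimizing a quadratic functional
    ([lax_milgram]), and square roots from a fixed point iteration that converges
    in norm ([sqrt_contraction]). Positive and negative parts are obtained from
    the square root of a square. *)

(** * The underlying real inner product *)

(** The norm and the inner product take their values in [R[i]], whose order is
    only partial. Their real parts determine them and live in a totally ordered
    field. *)
Definition rdot (R : realType) (H : hilbertType R) (h k : H) : R :=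
  complex.Re (inner h k).

Definition rnorm (R : realType) (H : hilbertType R) (h : H) : R :=
  complex.Re `|h|.

Local Notation "'[ h , k ]" := (rdot h k) : ring_scope.

Section real_inner_product.
Context {R : realType} {H : hilbertType R}.
Implicit Types (h k l : H) (a : R) (z : R[i]).

Lemma innerDr h k l : inner h (k + l) = inner h k + inner h l.
Proof. by rewrite /inner linearDl. Qed.

Lemma innerZr z h k : inner h (z *: k) = z * inner h k.
Proof. by rewrite /inner linearZl_LR. Qed.

Lemma innerC h k : inner h k = (inner k h)^*.
Proof. by rewrite /inner hermitian_subproof expr0 mul1r. Qed.

Lemma rdotC h k : '[h, k] = '[k, h].
Proof. by rewrite /rdot innerC; case: (inner k h). Qed.

Lemma rdotDr h k l : '[h, k + l] = '[h, k] + '[h, l].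
Proof. by rewrite /rdot innerDr; case: (inner h k); case: (inner h l). Qed.

Lemma rdotDl h k l : '[k + l, h] = '[k, h] + '[l, h].
Proof. by rewrite rdotC rdotDr !(rdotC h). Qed.

Lemma rdotZr a h k : '[h, a%:C *: k] = a * '[h, k].
Proof.
by rewrite /rdot innerZr; case: (inner h k) => x y /=; rewrite mul0r subr0.
Qed.

Lemma rdotZl a h k : '[a%:C *: h, k] = a * '[h, k].
Proof. by rewrite rdotC rdotZr rdotC. Qed.

Lemma rdot0r h : '[h, 0] = 0.
Proof. by have := rdotZr 0 h 0; rewrite mul0r scaler0. Qed.

Lemma rdot0l h : '[0, h] = 0.
Proof. by rewrite rdotC rdot0r. Qed.

Lemma rdotNr h k : '[h, - k] = - '[h, k].
Proof. by apply: (addrI '[h, k]); rewrite -rdotDr !subrr rdot0r. Qed.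

Lemma rdotNl h k : '[- h, k] = - '[h, k].
Proof. by rewrite rdotC rdotNr rdotC. Qed.

Lemma rdotBr h k l : '[h, k - l] = '[h, k] - '[h, l].
Proof. by rewrite rdotDr rdotNr. Qed.

Lemma rdotBl h k l : '[k - l, h] = '[k, h] - '[l, h].
Proof. by rewrite rdotDl rdotNl. Qed.

Definition rdotE := (rdotDr, rdotDl, rdotNr, rdotNl, rdotZr, rdotZl).

(** The imaginary part of the inner product is recovered by multiplying one
    argument by i; this is how identities for [rdot] become identities for
    [inner] when the operators involved are complex linear. *)
Lemma Im_inner h k : complex.Im (inner h k) = - '[h, 'i%C *: k].
Proof.
rewrite /rdot innerZr; case: (inner h k) => x y /=.
by rewrite mul0r mul1r sub0r opprK.
Qed.

Lemma innerE h k : inner h k = '[h, k] +i* - '[h, 'i%C *: k].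
Proof. by rewrite -Im_inner /rdot; case: (inner h k). Qed.

Lemma rdot_normE h : '[h, h] = rnorm h ^+ 2.
Proof.
rewrite /rdot /inner -hilbert_normE /rnorm.
have /ger0_Im := normr_ge0 h.
by case: `|h| => x y /= ->; rewrite mulr0 subr0 expr2.
Qed.

Lemma normE h : `|h| = (rnorm h)%:C.
Proof.
rewrite /rnorm; have /ger0_Im := normr_ge0 h.
by case: `|h| => x y /= ->.
Qed.

Lemma rnorm_ge0 h : 0 <= rnorm h.
Proof. by have := normr_ge0 h; rewrite normE ler0c. Qed.

Lemma rnorm0 : rnorm (0 : H) = 0.
Proof. by rewrite /rnorm normr0. Qed.

Lemma rnorm0_eq0 h : rnorm h = 0 -> h = 0.
Proof. by move=> h0; apply/eqP; rewrite -normr_eq0 normE h0. Qed.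

Lemma rdot_ge0 h : 0 <= '[h, h].
Proof. by rewrite rdot_normE sqr_ge0. Qed.

Lemma rdot_eq0 h : '[h, h] = 0 -> h = 0.
Proof. by rewrite rdot_normE => /eqP; rewrite sqrf_eq0 => /eqP/rnorm0_eq0. Qed.

Lemma rdot_gt0 h : h != 0 -> 0 < '[h, h].
Proof.
by move=> h0; rewrite lt0r rdot_ge0 andbT; apply: contra h0 => /eqP/rdot_eq0->.
Qed.

Lemma rdot_inj h k : (forall l, '[l, h] = '[l, k]) -> h = k.
Proof.
move=> hk; apply/eqP; rewrite -subr_eq0; apply/eqP/rdot_eq0.
by rewrite rdotBr hk subrr.
Qed.

Lemma rnormD h k : rnorm (h + k) <= rnorm h + rnorm k.
Proof. by have := ler_normD h k; rewrite !normE -raddfD lecR. Qed.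

Lemma rnormN h : rnorm (- h) = rnorm h.
Proof. by rewrite /rnorm normrN. Qed.

Lemma rnormB h k : rnorm (h - k) = rnorm (k - h).
Proof. by rewrite -rnormN opprB. Qed.

Lemma rnormZ a h : rnorm (a%:C *: h) = `|a| * rnorm h.
Proof.
apply: complexI; rewrite -normE normrZ normE normc_def /= expr0n addr0 sqrtr_sqr.
by rewrite -rmorphM.
Qed.

(** Completeness with real tolerances, so that the limits below are obtained by
    real estimates and without filters. *)
Lemma rnorm_complete (u : nat -> H) :
  (forall e, 0 < e -> exists N, forall m n, (N <= m)%N -> (N <= n)%N ->
     rnorm (u m - u n) < e) ->
  exists l, forall e, 0 < e -> exists N, forall n, (N <= n)%N ->
     rnorm (u n - l) < e.
Proof.
move=> u_cauchy.
have : cvg (u @ \oo).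
  apply/cauchy_cvgP/cauchy_ballP => e e0.
  have [e1 e10 ee1] : exists2 e1 : R, 0 < e1 & e1%:C = e.
    case: e e0 => x y; rewrite ltcE /= => /andP[/eqP -> x0].
    by exists x.
  have [N uN] := u_cauchy _ e10.
  have uoo : (u @ \oo) [set u n | n in [set n | (N <= n)%N]].
    by exists N => // n Nn; exists n.
  exists ([set u n | n in [set n | (N <= n)%N]],
          [set u n | n in [set n | (N <= n)%N]]) => //.
  move=> [_ _] /= [[m Nm <-] [n Nn <-]].
  by rewrite -ball_normE /ball_ /= normE -ee1 ltcR uN.
move=> /cvg_ex[l ul]; exists l => e e0.
have /cvgrPdist_lt /(_ e%:C) := ul.
rewrite ltcR => /(_ e0) [N _ uN]; exists N => n Nn.
by have := uN n Nn; rewrite /= normE ltcR rnormB.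
Qed.

End real_inner_product.

(** * Bounded, symmetric and positive operators *)

Lemma quadratic_discriminant (R : realFieldType) (a b c : R) :
  0 <= c -> (forall s, 0 <= a + 2 * s * b + s ^+ 2 * c) -> b ^+ 2 <= a * c.
Proof.
rewrite le_eqVlt => /predU1P[<-|c0] q.
  have [-> | b0] := eqVneq b 0; first by rewrite expr0n mulr0.
  have := q (- (a + 1) / (2 * b)).
  have -> : a + 2 * (- (a + 1) / (2 * b)) * b
    + (- (a + 1) / (2 * b)) ^+ 2 * 0 = -1 by field.
  by rewrite lerNr oppr0 ler10.
have := q (- b / c).
have -> : a + 2 * (- b / c) * b + (- b / c) ^+ 2 * c = (a * c - b ^+ 2) / c.
  by field; rewrite gt_eqF.
by rewrite pmulr_lge0 ?invr_gt0// subr_ge0.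
Qed.

Lemma le0_of_small (R : realFieldType) (a K : R) :
  0 <= K -> (forall d, 0 < d -> a <= d * K) -> a <= 0.
Proof.
move=> K0 aK; rewrite leNgt; apply/negP => a0.
have K1 : 0 < K + 1 by lra.
have := aK (a / (K + 1)) (divr_gt0 a0 K1).
rewrite mulrAC ler_pdivlMr //; nra.
Qed.

Section bounded_operators.
Context {R : realType} {H : hilbertType R}.
Implicit Types (h k l : H) (a : R) (z : R[i]) (T S A B : H -> H).

Lemma bop_lin T : bounded_op T -> linear T.
Proof. by case. Qed.

Lemma bopD T h k : bounded_op T -> T (h + k) = T h + T k.
Proof. by move=> [/(_ 1 h k)]; rewrite !scale1r. Qed.

Lemma bop0 T : bounded_op T -> T 0 = 0.
Proof. by move=> bT; apply: (addrI (T 0)); rewrite -(bopD 0 0 bT) !addr0. Qed.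

Lemma bopZ T z h : bounded_op T -> T (z *: h) = z *: T h.
Proof. by move=> bT; have := bT.1 z h 0; rewrite (bop0 bT) !addr0. Qed.

Lemma bopN T h : bounded_op T -> T (- h) = - T h.
Proof. by move=> bT; rewrite -scaleN1r (bopZ _ _ bT) scaleN1r. Qed.

Lemma bopB T h k : bounded_op T -> T (h - k) = T h - T k.
Proof. by move=> bT; rewrite (bopD _ _ bT) (bopN _ bT). Qed.

Lemma bop_rbound T : bounded_op T ->
  exists2 M : R, 0 < M & forall h, rnorm (T h) <= M * rnorm h.
Proof.
move=> [_ [M TM]]; exists (`|complex.Re M| + 1) => [|h].
  by rewrite ltr_wpDl.
have : complex.Re `|T h| <= complex.Re (M * `|h|).
  by have := TM h; rewrite lecE => /andP[].
rewrite normE [`|h|]normE; case: M {TM} => x y /= ; rewrite mulr0 subr0.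
have := rnorm_ge0 h; have := ler_norm x.
rewrite /rnorm; nra.
Qed.

Lemma rbound_bop T (M : R) : linear T ->
  (forall h, rnorm (T h) <= M * rnorm h) -> bounded_op T.
Proof.
by move=> lT TM; split => //; exists M%:C => h; rewrite !normE -rmorphM lecR.
Qed.

Lemma bop_id : bounded_op (fun h : H => h).
Proof. by apply: (@rbound_bop _ 1) => // h; rewrite mul1r. Qed.

Lemma bop_comp T S : bounded_op T -> bounded_op S ->
  bounded_op (fun h => T (S h)).
Proof.
move=> bT bS; have [M M0 TM] := bop_rbound bT; have [N N0 SN] := bop_rbound bS.
apply: (@rbound_bop _ (M * N)) => [z h k|h]; first by rewrite bS.1 bT.1.
by rewrite (le_trans (TM _)) // -mulrA ler_pM2l.
Qed.

Lemma bop_add T S : bounded_op T -> bounded_op S ->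
  bounded_op (fun h => T h + S h).
Proof.
move=> bT bS; have [M M0 TM] := bop_rbound bT; have [N N0 SN] := bop_rbound bS.
apply: (@rbound_bop _ (M + N)) => [z h k|h].
  by rewrite bS.1 bT.1 scalerDr addrACA.
by rewrite (le_trans (rnormD _ _)) // mulrDl lerD.
Qed.

Lemma bop_scale T a : bounded_op T -> bounded_op (fun h => a%:C *: T h).
Proof.
move=> bT; have [M M0 TM] := bop_rbound bT.
apply: (@rbound_bop _ (`|a| * M)) => [z h k|h].
  by rewrite bT.1 scalerDr !scalerA mulrC.
by rewrite rnormZ -mulrA ler_wpM2l.
Qed.

Lemma bop_sub T S : bounded_op T -> bounded_op S ->
  bounded_op (fun h => T h - S h).
Proof.
move=> bT bS; suff -> : (fun h => T h - S h) = fun h => T h + (-1)%:C *: S h.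
  by apply: bop_add => //; apply: bop_scale.
by apply/funext => h; rewrite rmorphN scaleN1r.
Qed.

Lemma rdot_skew h k : '[k, 'i%C *: h] = - '[h, 'i%C *: k].
Proof.
rewrite -Im_inner -[LHS]opprK -Im_inner innerC.
by case: (inner h k) => x y /=; rewrite opprK.
Qed.

Lemma rdotZJ z h k : '[z *: h, k] = '[h, z^* *: k].
Proof.
by rewrite /rdot (innerC (z *: h)) !innerZr rmorphM (innerC h).
Qed.

Definition symmetric_op T := forall h k, '[h, T k] = '[T h, k].

Lemma inner_adjoint T S : bounded_op T -> bounded_op S ->
  (forall h k, '[h, T k] = '[S h, k]) ->
  forall h k, inner h (T k) = inner (S h) k.
Proof. by move=> bT bS TS h k; rewrite !innerE -(bopZ _ _ bT) !TS. Qed.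

(** The real adjoint relation suffices, since both operators are complex
    linear. *)
Lemma adjoint_unique T S : bounded_op T -> bounded_op S ->
  (forall h k, '[h, T k] = '[S h, k]) -> adjoint T = S.
Proof.
move=> bT bS TS; rewrite /adjoint.
set P := [set _ | _]; have PS : P S by split => //; apply: inner_adjoint.
have [_ TxS] : P (xget (cst 0) P) by apply: xgetI PS.
apply/funext => h; apply: rdot_inj => l.
by rewrite rdotC [RHS]rdotC -TS /rdot TxS.
Qed.

Lemma positive_ge0 T h : positive_op T -> 0 <= '[h, T h].
Proof. by move/(_ h); rewrite lecE => /andP[]. Qed.

(** Polarization: over the complex numbers a real quadratic form has a
    Hermitian polar form. *)
Lemma positive_sym T : bounded_op T -> positive_op T -> symmetric_op T.
Proof.
move=> bT pT.
have Tim h : '[h, 'i%C *: T h] = 0.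
  by have /ger0_Im := pT h; rewrite Im_inner => /eqP; rewrite oppr_eq0 => /eqP.
have iT h k : '[h, 'i%C *: T k] = '[T h, 'i%C *: k].
  have := Tim (h + k); rewrite (bopD _ _ bT) scalerDr !rdotE !Tim.
  by rewrite (rdot_skew (T h) k) -/(symmetric_op T); lra.
move=> h k; have := iT h (- 'i%C *: k).
rewrite (bopZ _ _ bT) !scalerA mulrN -expr2 sqr_i opprK !scale1r //.
Qed.

Lemma positiveI T : bounded_op T -> symmetric_op T ->
  (forall h, 0 <= '[h, T h]) -> positive_op T.
Proof.
move=> bT sT pT h; rewrite innerE lecE /= pT andbT oppr_eq0.
have := rdot_skew (T h) h; have := sT h ('i%C *: h).
rewrite (bopZ _ _ bT) => <- ?; apply/eqP; lra.
Qed.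

(** The Cauchy-Schwarz inequality for the semi-inner product '[h, T k]. *)
Lemma positive_CauchySchwarz T h k : bounded_op T -> positive_op T ->
  '[h, T k] ^+ 2 <= '[h, T h] * '[k, T k].
Proof.
move=> bT pT; apply: quadratic_discriminant => [|s]; first exact: positive_ge0.
have := positive_ge0 (h + s%:C *: k) pT.
have : '[k, T h] = '[h, T k] by rewrite (positive_sym bT pT) rdotC.
rewrite (bopD _ _ bT) (bopZ _ _ bT) !rdotE => ->; congr (_ <= _); ring.
Qed.

Lemma positive_id : positive_op (fun h : H => h).
Proof. by apply: positiveI => // [|h]; [exact: bop_id | exact: rdot_ge0]. Qed.

Lemma rdot_CauchySchwarz h k : `|'[h, k]| <= rnorm h * rnorm k.
Proof.
rewrite -(@ler_pXn2r _ 2) ?nnegrE ?mulr_ge0 ?rnorm_ge0 //.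
rewrite real_normK ?num_real // exprMn -!rdot_normE.
exact: (positive_CauchySchwarz h k bop_id positive_id).
Qed.

Lemma rdot_le_rnorm h k : '[h, k] <= rnorm h * rnorm k.
Proof. exact: le_trans (ler_norm _) (rdot_CauchySchwarz _ _). Qed.

Lemma positive_eq0 T h : bounded_op T -> positive_op T ->
  '[h, T h] = 0 -> T h = 0.
Proof.
move=> bT pT h0; apply: rdot_inj => l; rewrite rdot0r; apply/eqP.
rewrite -sqrf_eq0 eq_le sqr_ge0 andbT.
by rewrite (le_trans (positive_CauchySchwarz _ _ bT pT)) // h0 mulr0.
Qed.

Lemma rdot_op_bound T : bounded_op T ->
  exists2 N : R, 0 < N & forall h, '[h, T h] <= N * '[h, h].
Proof.
move=> bT; have [N N0 TN] := bop_rbound bT; exists N => // h.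
rewrite (le_trans (rdot_le_rnorm _ _)) // rdot_normE expr2.
by rewrite mulrCA ler_wpM2l ?rnorm_ge0.
Qed.

Lemma rnorm_le_of_sqr h (c : R) : 0 <= c -> '[h, h] <= c * rnorm h ->
  rnorm h <= c.
Proof.
rewrite rdot_normE => c0; have := rnorm_ge0 h.
rewrite le_eqVlt => /predU1P[<-//|h0]; by rewrite expr2 ler_pM2r.
Qed.

Lemma positive_contraction T : bounded_op T -> positive_op T ->
  (forall h, '[h, T h] <= '[h, h]) -> forall h, rnorm (T h) <= rnorm h.
Proof.
move=> bT pT T1 h.
have := positive_CauchySchwarz (T h) h bT pT.
have := T1 h; have := T1 (T h); have := positive_ge0 h pT.
have := rnorm_ge0 h; have := rnorm_ge0 (T h); rewrite !rdot_normE.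
set x := rnorm (T h); set y := rnorm h; set p := '[_, _]; set q := '[_, _].
move=> x0 y0 q0 qx py pqx; rewrite leNgt; apply/negP => yx.
have : (x ^+ 2) ^+ 2 <= x ^+ 2 * y ^+ 2.
  by apply: le_trans pqx _; apply: ler_pM => //; exact: positive_ge0.
have : y ^+ 2 < x ^+ 2 by rewrite ltr_pXn2r.
have : 0 < x by lra.
nra.
Qed.

Definition coercive (c : R) T := forall h, c * '[h, h] <= '[h, T h].

(** The symmetric case of the Lax-Milgram theorem. The solution minimizes
    '[x, A x] - 2 f x: the derivative of this functional in the direction k is
    2 ('[x, A k] - f k), and near the infimum it is small because the functional
    is bounded below along the line x + s k. *)
Lemma lax_milgram A (c : R) (f : H -> R) (L : R) :
  bounded_op A -> positive_op A -> 0 < c -> coercive c A ->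
  (forall h k, f (h + k) = f h + f k) ->
  (forall a h, f (a%:C *: h) = a * f h) ->
  (forall h, `|f h| <= L * rnorm h) ->
  exists x, forall k, f k = '[x, A k].
Proof.
move=> bA pA c0 Ac fD fZ fL; have sA := positive_sym bA pA.
pose J x := '[x, A x] - 2 * f x.
have JD x k s : J (x + s%:C *: k) =
    J x + 2 * s * ('[x, A k] - f k) + s ^+ 2 * '[k, A k].
  rewrite /J (bopD _ _ bA) (bopZ _ _ bA) !rdotE fD fZ (sA k x) (rdotC (A k)); ring.
have Jlb x : - (L ^+ 2 / c) <= J x.
  rewrite /J; have := Ac x; rewrite rdot_normE.
  have : f x <= L * rnorm x := le_trans (ler_norm _) (fL x).
  move: (rnorm x) => n fx cn.
  suff : 0 <= c * n ^+ 2 - 2 * L * n + L ^+ 2 / c by lra.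
  have -> : c * n ^+ 2 - 2 * L * n + L ^+ 2 / c = (c * n - L) ^+ 2 / c.
    by field; rewrite gt_eqF.
  by rewrite divr_ge0 ?sqr_ge0 // ltW.
have Jinf : has_inf (range J).
  split; first by exists (J 0), 0.
  by exists (- (L ^+ 2 / c)) => _ [x _ <-].
have Jm x : inf (range J) <= J x by apply: ge_inf; [exact: Jinf.2 | exists x].
set m := inf (range J) in Jm.
have near_min e x k : J x < m + e -> ('[x, A k] - f k) ^+ 2 <= e * '[k, A k].
  move=> Jx; apply: quadratic_discriminant => [|s]; first exact: positive_ge0.
  have := Jm (x + s%:C *: k); rewrite JD; lra.
have /choice[u uJ] : forall n : nat, exists x, J x < m + n.+1%:R^-1.
  move=> n; have [|_ [x _ <-] Jx] := @inf_adherent _ (range J) n.+1%:R^-1 _ Jinf.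
    by rewrite invr_gt0.
  by exists x.
have nat_small (d : R) : 0 < d ->
    exists N, forall n, (N <= n)%N -> J (u n) < m + d.
  move=> d0; have [N _ Nd] := near_infty_natSinv_lt (PosNum d0).
  exists N => n /Nd /= nd; apply: lt_trans (uJ n) _; by rewrite ltrD2l.
have ucauchy x y d : 0 < d -> J x < m + d -> J y < m + d ->
    c * rnorm (x - y) ^+ 2 <= 4 * d.
  move=> d0 Jx Jy; rewrite -rdot_normE; apply: le_trans (Ac _) _.
  have := near_min _ _ (x - y) Jx; have := near_min _ _ (x - y) Jy.
  have : '[x - y, A (x - y)] = ('[x, A (x - y)] - f (x - y))
                             - ('[y, A (x - y)] - f (x - y)).
    by rewrite rdotBl; ring.
  have := positive_ge0 (x - y) pA.
  move: '[x - y, A (x - y)] ('[x, A (x - y)] - f (x - y))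
    ('[y, A (x - y)] - f (x - y)) => q v w q0 qvw wq vq.
  rewrite leNgt; apply/negP => dq.
  have : q * (q - 4 * d) <= 0.
    have -> : q * (q - 4 * d) = (v - w) ^+ 2 - 4 * (d * q) by rewrite qvw; ring.
    have := sqr_ge0 (v + w); nra.
  have : 0 < q by lra.
  nra.
(* By [ucauchy], J < m + c e ^ 2 / 8 confines two points to distance less
   than e. *)
have [|l ul] := @rnorm_complete _ _ u.
  move=> e e0; have d0 : 0 < c * e ^+ 2 / 8.
    by rewrite divr_gt0 // mulr_gt0 // exprn_gt0.
  have [N uN] := nat_small _ d0; exists N => i j iN jN.
  have := ucauchy _ _ _ d0 (uN _ iN) (uN _ jN) => cr.
  rewrite -(@ltr_pXn2r _ 2) ?nnegrE ?rnorm_ge0 ?ltW // -(ltr_pM2l c0).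
  have : 0 < c * e ^+ 2 by rewrite mulr_gt0 // exprn_gt0.
  lra.
exists l => k; apply/eqP; rewrite eq_sym -subr_eq0 -sqrf_eq0 eq_le sqr_ge0 andbT.
apply: (@le0_of_small _ _ (2 * '[A k, A k] + 2 * '[k, A k])) => [|d d0].
  by have := rdot_ge0 (A k); have := positive_ge0 k pA; lra.
have [N uN] := nat_small _ d0.
have [|N' uN'] := ul (Num.min d 1); first by rewrite lt_min d0 ltr01.
have := near_min _ _ k (uN _ (leq_maxl N N')).
have := uN' _ (leq_maxr N N'); set x := u _.
rewrite lt_min => /andP[xd x1].
have := positive_CauchySchwarz (l - x) (A k) bop_id positive_id.
rewrite rdotBl (rdot_normE (l - x)) rnormB.
have := rdot_ge0 (A k); have := positive_ge0 k pA; have := rnorm_ge0 (x - l).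
move: (rnorm _) xd x1 '[A k, A k] '[k, A k] '[l, A k] '[x, A k] (f k).
move=> n nd n1 p q a b e n0 q0 p0 abn ben.
have : n ^+ 2 <= d by nra.
have : (a - e) ^+ 2 <= 2 * (a - b) ^+ 2 + 2 * (b - e) ^+ 2.
  have -> : a - e = (a - b) + (b - e) by ring.
  have := sqr_ge0 ((a - b) - (b - e)); nra.
nra.
Qed.

(** The Riesz representation of the functional k |-> '[h, T k] is the case of
    [lax_milgram] where A is the identity. *)
Lemma adjoint_exists T : bounded_op T ->
  exists2 S, bounded_op S & forall h k, '[h, T k] = '[S h, k].
Proof.
move=> bT; have [M M0 TM] := bop_rbound bT.
have /choice[S TS] : forall h, exists x, forall k, '[h, T k] = '[x, k].
  move=> h; apply: (@lax_milgram (fun h => h) 1 _ (M * rnorm h)) => //.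
  - exact: bop_id.
  - exact: positive_id.
  - by move=> k; rewrite mul1r.
  - by move=> k l; rewrite (bopD _ _ bT) rdotE.
  - by move=> a k; rewrite (bopZ _ _ bT) rdotE.
  - move=> k; rewrite (le_trans (rdot_CauchySchwarz _ _)) //.
    by rewrite -mulrA mulrCA ler_wpM2l ?rnorm_ge0.
exists S => //; apply: (@rbound_bop _ M) => [z h k|h].
  apply: rdot_inj => l; rewrite rdotDr ![ '[l, _] ]rdotC -!TS.
  by rewrite rdotZJ -TS rdotDl rdotZJ (bopZ _ _ bT).
apply: rnorm_le_of_sqr; first by rewrite mulr_ge0 ?rnorm_ge0 ?ltW.
rewrite -TS (le_trans (rdot_le_rnorm _ _)) //.
by rewrite -mulrA mulrCA ler_wpM2l ?rnorm_ge0.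
Qed.

Lemma adjointP T : bounded_op T ->
  bounded_op (adjoint T) /\ forall h k, '[h, T k] = '[adjoint T h, k].
Proof.
by move=> bT; have [S bS TS] := adjoint_exists bT; rewrite (adjoint_unique bT bS).
Qed.

Lemma coercive_inverse A (c : R) :
  bounded_op A -> positive_op A -> 0 < c -> coercive c A ->
  exists W, [/\ bounded_op W, forall h, A (W h) = h & forall h, W (A h) = h].
Proof.
move=> bA pA c0 Ac; have sA := positive_sym bA pA.
have Ainj h k : A h = A k -> h = k.
  move=> hk; apply/eqP; rewrite -subr_eq0; apply/eqP/rdot_eq0.
  have := Ac (h - k); rewrite (bopB _ _ bA) hk subrr rdot0r pmulr_rle0 // => ?.
  by apply/eqP; rewrite eq_le rdot_ge0 andbT.
have /choice[W AW] : forall h, exists x, A x = h.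
  move=> h; have [|||x hx] := @lax_milgram A c (fun k => '[h, k]) (rnorm h) bA pA c0 Ac.
  - by move=> k l; rewrite rdotE.
  - by move=> a k; rewrite rdotE.
  - exact: rdot_CauchySchwarz.
  by exists x; apply: rdot_inj => l; rewrite rdotC -sA -hx rdotC.
have WA h : W (A h) = h by apply: Ainj; rewrite AW.
exists W; split => //; apply: (@rbound_bop _ c^-1) => [z h k|h].
  by apply: Ainj; rewrite bA.1 !AW.
apply: rnorm_le_of_sqr; first by rewrite mulr_ge0 ?rnorm_ge0 ?invr_ge0 ?ltW.
rewrite -mulrA mulrC ler_pdivlMr // mulrC (le_trans (Ac _)) // AW.
by rewrite (le_trans (rdot_le_rnorm _ _)) // mulrC.
Qed.

End bounded_operators.

(** * Square roots of positive operators *)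

(** The inner product turns an identity between vectors into one between real
    numbers. *)
Ltac vector_ring := apply: rdot_inj => ?; rewrite ?rdotE; ring.

Section square_root.
Context {R : realType} {H : hilbertType R}.
Implicit Types (h k l : H) (X Y A B T S : H -> H).

Lemma rnorm_small_eq0 h (K : R) :
  0 <= K -> (forall d, 0 < d -> rnorm h <= d * K) -> h = 0.
Proof.
move=> K0 hK; apply/rnorm0_eq0/eqP; rewrite eq_le rnorm_ge0 andbT.
exact: le0_of_small hK.
Qed.

(** Successive approximations of the solution of 2 Y = X + Y ^ 2, that is, of
    Y = 1 - sqrt (1 - X). They are polynomials in X with nonnegative
    coefficients. *)
Fixpoint sqrt_iter X n : H -> H :=
  if n is n'.+1 then
    fun h => (2^-1)%:C *: (X h + sqrt_iter X n' (sqrt_iter X n' h))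
  else fun=> 0.

(** The same iteration at X = 1; its convergence controls that of the
    operators. *)
Fixpoint scalar_sqrt_iter n : R :=
  if n is n'.+1 then 2^-1 * (1 + scalar_sqrt_iter n' ^+ 2) else 0.

Local Notation y := scalar_sqrt_iter.

Lemma scalar_sqrt_iter_bound n : 0 <= y n <= 1.
Proof. by elim: n => [|n /andP[? ?]] /=; apply/andP; split; nra. Qed.

Lemma scalar_sqrt_iter_nondecreasing n m : (n <= m)%N -> y n <= y m.
Proof.
move=> nm; have ynd : {homo y : i j / (i <= j)%N >-> i <= j}.
  apply: homo_leq => [//|? ? ?|i]; first exact: le_trans.
  by have := sqr_ge0 (y i - 1) => /=; lra.
exact: ynd.
Qed.

Lemma bop_sqrt_iter X n : bounded_op X -> bounded_op (sqrt_iter X n).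
Proof.
move=> bX; elim: n => [|n bY] /=.
  apply: (@rbound_bop _ _ _ 0) => [z h k|h]; last by rewrite rnorm0 mul0r.
  by rewrite scaler0 addr0.
by apply: bop_scale; apply: bop_add => //; apply: bop_comp.
Qed.

Lemma sym_sqrt_iter X n : symmetric_op X -> symmetric_op (sqrt_iter X n).
Proof.
move=> sX; elim: n => [|n sY] h k /=; first by rewrite rdot0r rdot0l.
by rewrite !rdotE sX !sY.
Qed.

Lemma comm_sqrt_iter X B n : bounded_op B ->
  (forall h, B (X h) = X (B h)) ->
  forall h, B (sqrt_iter X n h) = sqrt_iter X n (B h).
Proof.
move=> bB BX; elim: n => [|n BY] h /=; first exact: bop0.
by rewrite (bopZ _ _ bB) (bopD _ _ bB) BX !BY.
Qed.

Lemma rnorm_half h : rnorm ((2^-1)%:C *: h) = 2^-1 * rnorm h.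
Proof. by rewrite rnormZ ger0_norm // invr_ge0. Qed.

Section contraction.
Context X (bX : bounded_op X) (X1 : forall h, rnorm (X h) <= rnorm h).

Local Notation Y := (sqrt_iter X).

Let bY n : bounded_op (Y n) := bop_sqrt_iter n bX.

Lemma sqrt_iter_bound n h : rnorm (Y n h) <= y n * rnorm h.
Proof.
elim: n h => [|n IH] h /=; first by rewrite rnorm0 mul0r.
rewrite rnorm_half -mulrA ler_pM2l ?invr_gt0 //.
rewrite (le_trans (rnormD _ _)) // mulrDl mul1r lerD //.
rewrite (le_trans (IH _)) // expr2 -mulrA ler_wpM2l //.
by have /andP[] := scalar_sqrt_iter_bound n.
Qed.

(** Since Y' ^ 2 - Y ^ 2 = Y' (Y' - Y) + (Y' - Y) Y, increments obey the same
    recursion as the increments of the scalar sequence at X = 1. *)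
Lemma sqrt_iter_step n h :
  rnorm (Y n.+1 h - Y n h) <= (y n.+1 - y n) * rnorm h.
Proof.
elim: n h => [|n IH] h.
  by rewrite !subr0; exact: (sqrt_iter_bound 1).
have -> : Y n.+2 h - Y n.+1 h = (2^-1)%:C *:
    (Y n.+1 (Y n.+1 h - Y n h) + (Y n.+1 (Y n h) - Y n (Y n h))).
  have YS m : Y m.+1 h = (2^-1)%:C *: (X h + Y m (Y m h)) by [].
  rewrite (bopB _ _ (bY _)) !YS -scalerBr; congr (_ *: _); vector_ring.
rewrite rnorm_half.
have -> : y n.+2 - y n.+1 =
    2^-1 * (y n.+1 * (y n.+1 - y n) + (y n.+1 - y n) * y n).
  have yS m : y m.+1 = 2^-1 * (1 + y m ^+ 2) by [].
  have := yS n; have := yS n.+1; move: (y n.+2) (y n.+1) (y n) => *; lra.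
rewrite -mulrA ler_pM2l ?invr_gt0 // (le_trans (rnormD _ _)) // mulrDl.
have /andP[y0 _] := scalar_sqrt_iter_bound n.+1.
have dy : 0 <= y n.+1 - y n.
  by rewrite subr_ge0 scalar_sqrt_iter_nondecreasing.
apply: lerD.
  by rewrite (le_trans (sqrt_iter_bound _ _)) // -mulrA ler_wpM2l.
by rewrite (le_trans (IH _)) // -mulrA ler_wpM2l ?sqrt_iter_bound.
Qed.

Lemma sqrt_iter_dist n m h : (n <= m)%N ->
  rnorm (Y m h - Y n h) <= (y m - y n) * rnorm h.
Proof.
elim: m => [|m IH]; first by rewrite leqn0 => /eqP ->; rewrite !subrr rnorm0 mul0r.
rewrite leq_eqVlt => /predU1P[->|]; first by rewrite !subrr rnorm0 mul0r.
move=> /IH nm.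
have -> : Y m.+1 h - Y n h = (Y m.+1 h - Y m h) + (Y m h - Y n h).
  by rewrite addrA subrK.
have := sqrt_iter_step m h; have := rnormD (Y m.+1 h - Y m h) (Y m h - Y n h).
lra.
Qed.

Lemma scalar_sqrt_iter_cauchy (d : R) : 0 < d ->
  exists N, forall m, (N <= m)%N -> y m - y N < d.
Proof.
move=> d0; have ysup : has_sup (range y).
  split; first by exists (y 0), 0%N.
  by exists 1 => _ [n _ <-]; have /andP[] := scalar_sqrt_iter_bound n.
have [_ [N _ <-] yN] := sup_adherent d0 ysup; exists N => m _.
have : y m <= sup (range y) by apply: ub_le_sup; [exact: ysup.2 | exists m].
lra.
Qed.

(** The estimate is uniform on the unit ball, so algebraic properties of the
    iterates pass to the limit. *)
Lemma sqrt_iter_limit : exists Z : H -> H,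
  forall d, 0 < d -> exists N, forall n, (N <= n)%N ->
    forall h, rnorm (Z h - Y n h) <= d * rnorm h.
Proof.
have /choice[Z YZ] : forall h, exists l, forall e, 0 < e ->
    exists N, forall n, (N <= n)%N -> rnorm (Y n h - l) < e.
  move=> h; apply: rnorm_complete => e e0.
  have h0 := rnorm_ge0 h.
  have c0 : 0 < rnorm h + 1 by lra.
  have [N yN] := scalar_sqrt_iter_cauchy (divr_gt0 (divr_gt0 e0 (ltr0Sn R 1)) c0).
  have near n : (N <= n)%N -> rnorm (Y n h - Y N h) < e / 2.
    move=> Nn; apply: le_lt_trans (sqrt_iter_dist h Nn) _.
    have := yN _ Nn; have := scalar_sqrt_iter_nondecreasing Nn.
    rewrite ltr_pdivlMr // => ? ?; nra.
  exists N => m n /near mN /near; rewrite rnormB => nN.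
  have := rnormD (Y m h - Y N h) (Y N h - Y n h).
  by rewrite addrA subrK; lra.
exists Z => d d0; have [N yN] := scalar_sqrt_iter_cauchy d0.
exists N => n Nn h.
rewrite -subr_le0; apply: (@le0_of_small _ _ 1) => // e e0.
have [N' YN'] := YZ h e e0; have := YN' _ (leq_maxr n N').
have := sqrt_iter_dist h (leq_maxl n N').
have := yN _ (leq_trans Nn (leq_maxl n N')).
have := scalar_sqrt_iter_nondecreasing Nn.
move: (maxn n N') => m Nn' ym Ym.
rewrite rnormB => Zm; have := rnormD (Z h - Y m h) (Y m h - Y n h).
rewrite addrA subrK; have := rnorm_ge0 h; nra.
Qed.

Lemma sqrt_contraction : symmetric_op X -> exists Z, [/\ bounded_op Z,
   symmetric_op Z, forall h, rnorm (Z h) <= rnorm h,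
   forall h, X h + Z (Z h) = 2%:C *: Z h &
   forall B, bounded_op B -> (forall h, B (X h) = X (B h)) ->
     forall h, B (Z h) = Z (B h)].
Proof.
move=> sX; have [Z YZ] := sqrt_iter_limit.
have Yn1 n h : rnorm (Y n h) <= rnorm h.
  have /andP[_ y1] := scalar_sqrt_iter_bound n.
  by rewrite (le_trans (sqrt_iter_bound _ _)) // ler_piMl ?rnorm_ge0.
have Z1 h : rnorm (Z h) <= rnorm h.
  rewrite -subr_le0; apply: (@le0_of_small _ _ (rnorm h)) => [|d d0].
    exact: rnorm_ge0.
  have [n /(_ _ (leqnn n) h)] := YZ _ d0; have := Yn1 n h.
  by have := rnormD (Z h - Y n h) (Y n h); rewrite subrK; lra.
have lZ : linear Z.
  move=> z h k; apply/eqP; rewrite -subr_eq0; apply/eqP.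
  pose K := rnorm (z *: h + k) + complex.Re `|z| * rnorm h + rnorm k.
  have rnormZc l : rnorm (z *: l) = complex.Re `|z| * rnorm l.
    rewrite /rnorm normrZ [`|l|]normE; case: `|z| => a b /=.
    by rewrite mulr0 subr0.
  have z0 : 0 <= complex.Re `|z| by have := normr_ge0 z; rewrite lecE => /andP[].
  have K0 : 0 <= K by rewrite !addr_ge0 ?mulr_ge0 ?rnorm_ge0.
  apply: (rnorm_small_eq0 K0) => d d0; have [n /(_ _ (leqnn n)) Zn] := YZ _ d0.
  have -> : Z (z *: h + k) - (z *: Z h + Z k) =
      (Z (z *: h + k) - Y n (z *: h + k)) - z *: (Z h - Y n h) - (Z k - Y n k).
    rewrite (bop_lin (bY n)) scalerBr; vector_ring.
  have := rnormD (Z (z *: h + k) - Y n (z *: h + k) - z *: (Z h - Y n h))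
            (- (Z k - Y n k)).
  have := rnormD (Z (z *: h + k) - Y n (z *: h + k)) (- (z *: (Z h - Y n h))).
  rewrite !rnormN rnormZc; have := Zn (z *: h + k); have := Zn h; have := Zn k.
  rewrite /K; nra.
have bZ : bounded_op Z.
  by apply: (@rbound_bop _ _ _ 1) => // h; rewrite mul1r.
exists Z; split => //.
- move=> h k; apply/eqP; rewrite -subr_eq0 -normr_le0.
  apply: (@le0_of_small _ _ (2 * (rnorm h * rnorm k))) => [|d d0].
    by rewrite !mulr_ge0 ?rnorm_ge0.
  have [n /(_ _ (leqnn n)) Zn] := YZ _ d0.
  have -> : '[h, Z k] - '[Z h, k] = '[h, Z k - Y n k] - '[Z h - Y n h, k].
    by rewrite !rdotE (sym_sqrt_iter n sX h k); ring.
  have := ler_normB '[h, Z k - Y n k] '[Z h - Y n h, k].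
  have := rdot_CauchySchwarz h (Z k - Y n k).
  have := rdot_CauchySchwarz (Z h - Y n h) k.
  have := ler_wpM2l (rnorm_ge0 h) (Zn k).
  have := ler_wpM2r (rnorm_ge0 k) (Zn h).
  lra.
- move=> h; apply/eqP; rewrite -subr_eq0; apply/eqP.
  apply: (@rnorm_small_eq0 _ (4 * rnorm h)) => [|d d0].
    by rewrite mulr_ge0 ?rnorm_ge0.
  have [n Zn] := YZ _ d0.
  have -> : X h + Z (Z h) - 2%:C *: Z h =
      (Z (Z h) - Y n (Z h)) + Y n (Z h - Y n h)
      - 2%:C *: (Z h - Y n.+1 h).
    have -> : Y n.+1 h = (2^-1)%:C *: (X h + Y n (Y n h)) by [].
    by rewrite (bopB _ _ (bY n)); apply: rdot_inj => l; rewrite !rdotE; field.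
  have := rnormD (Z (Z h) - Y n (Z h) + Y n (Z h - Y n h))
    (- (2%:C *: (Z h - Y n.+1 h))).
  have := rnormD (Z (Z h) - Y n (Z h)) (Y n (Z h - Y n h)).
  rewrite rnormN rnormZ [`|2|]ger0_norm //.
  have := Yn1 n (Z h - Y n h); have := Zn _ (leqnn n) (Z h).
  have := Zn _ (leqnn n) h; have := Zn _ (leqnSn n) h.
  have := ler_wpM2l (ltW d0) (Z1 h); lra.
- move=> B bB BX h; apply/eqP; rewrite -subr_eq0; apply/eqP.
  have [M M0 BM] := bop_rbound bB.
  apply: (@rnorm_small_eq0 _ (M * rnorm h + rnorm (B h))) => [|d d0].
    by rewrite addr_ge0 ?mulr_ge0 ?rnorm_ge0 ?ltW.
  have [n /(_ _ (leqnn n)) Zn] := YZ _ d0.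
  have -> : B (Z h) - Z (B h) = B (Z h - Y n h) - (Z (B h) - Y n (B h)).
    by rewrite (bopB _ _ bB) (comm_sqrt_iter n bB BX) opprB addrA subrK.
  have := rnormD (B (Z h - Y n h)) (- (Z (B h) - Y n (B h))).
  rewrite rnormN; have := BM (Z h - Y n h); have := Zn (B h).
  have := ler_wpM2l (ltW M0) (Zn h); lra.
Qed.

End contraction.
End square_root.

Section positive_square_root.
Context {R : realType} {H : hilbertType R}.
Implicit Types (h k l : H) (A B T S : H -> H).

Definition commute_op A B := forall h, A (B h) = B (A h).

(** After scaling, A = N (1 - X) with X a positive contraction, and
    sqrt A = sqrt N (1 - Z) where 2 Z = X + Z ^ 2. *)
Lemma positive_sqrt A : bounded_op A -> positive_op A ->
  exists M, [/\ bounded_op M, positive_op M, forall h, M (M h) = A h &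
    forall B, bounded_op B -> commute_op B A -> commute_op B M].
Proof.
move=> bA pA; have [N N0 Ale] := rdot_op_bound bA.
pose X h := h - N^-1%:C *: A h.
have bX : bounded_op X by apply: bop_sub; [exact: bop_id | exact: bop_scale].
have sX : symmetric_op X.
  by move=> h k; rewrite !rdotE (positive_sym bA pA).
have Xge0 h : 0 <= '[h, X h].
  by rewrite !rdotE subr_ge0 mulrC ler_pdivrMr // mulrC.
have Xle h : '[h, X h] <= '[h, h].
  rewrite !rdotE gerBl mulr_ge0 //; last exact: positive_ge0.
  by rewrite invr_ge0 ltW.
have pX := positiveI bX sX Xge0.
have [Z [bZ sZ Z1 XZ ZC]] := sqrt_contraction bX (positive_contraction bX pX Xle) sX.
pose M h := (Num.sqrt N)%:C *: (h - Z h).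
have bM : bounded_op M by apply: bop_scale; apply: bop_sub => //; exact: bop_id.
exists M; split => // [|h|B bB BA h].
- apply: positiveI => // [h k|h]; first by rewrite !rdotE sZ.
  rewrite !rdotE mulr_ge0 ?sqrtr_ge0 // subr_ge0.
  rewrite (le_trans (rdot_le_rnorm _ _)) // rdot_normE expr2.
  by rewrite ler_wpM2l ?rnorm_ge0.
- rewrite /M (bopZ _ _ bZ) (bopB _ _ bZ) -scalerBr scalerA -rmorphM.
  rewrite -expr2 sqr_sqrtr ?ltW //.
  have -> : h - Z h - (Z h - Z (Z h)) = h - X h.
    have := XZ h => /(congr1 (fun v => v - X h)).
    rewrite [X h + _]addrC addrK => ->; vector_ring.
  rewrite /X opprB addrC subrK scalerA -rmorphM mulfV ?gt_eqF // scale1r //.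
- rewrite /M (bopZ _ _ bB) (bopB _ _ bB) ZC // => k.
  by rewrite /X (bopB _ _ bB) (bopZ _ _ bB) BA.
Qed.

(** With M = sqrt A, the operator A B = M B M is manifestly positive. *)
Lemma positive_comp A B : bounded_op A -> positive_op A ->
  bounded_op B -> positive_op B -> commute_op B A ->
  positive_op (fun h => A (B h)).
Proof.
move=> bA pA bB pB BA h; have [M [bM pM MM MC]] := positive_sqrt bA pA.
by rewrite -MM (inner_adjoint bM bM (positive_sym bM pM)) -MC.
Qed.

(** The square root of a coercive operator is invertible: its inverse is
    A^-1 sqrt A. *)
Lemma coercive_sqrt A (c : R) :
  bounded_op A -> positive_op A -> 0 < c -> coercive c A ->
  exists T S, [/\ bounded_op T /\ bounded_op S,
    symmetric_op T /\ symmetric_op S, forall h, T (T h) = A h,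
    (forall h, T (S h) = h) /\ (forall h, S (T h) = h) &
    forall B, bounded_op B -> commute_op B A -> commute_op B S].
Proof.
move=> bA pA c0 Ac; have [T [bT pT TT TC]] := positive_sqrt bA pA.
have sT := positive_sym bT pT.
have [W [bW AW WA]] := coercive_inverse bA pA c0 Ac.
have ST h : W (T (T h)) = h by rewrite TT WA.
have TTW h : T (T (W h)) = h by rewrite TT AW.
have WT h : W (T h) = T (W h) by rewrite -{1}(TTW h) ST.
have TS h : T (W (T h)) = h by rewrite WT TTW.
exists T, (fun h => W (T h)); split => //.
- by split=> //; apply: bop_comp.
- split=> // h k; rewrite -{1}[h]TS -sT TS //.
- move=> B bB BA h; have BT := TC _ bB BA.
  by rewrite -{2}[h]TS BT ST.
Qed.

End positive_square_root.

(** * Finite additivity of operator valued measures *)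

Section additivity.
Context {R : realType} {d : measure_display} {X : measurableType d}.
Implicit Types (nu : set X -> R[i]) (A B : set X).

Lemma complex_measure0 nu : complex_measure nu -> nu set0 = 0.
Proof.
move=> /(_ (fun=> set0) (fun=> measurable0)) nu0.
have /nu0 nucvg : trivIset setT (fun _ : nat => set0 : set X).
  by apply/trivIsetP => i j _ _ _; rewrite set0I.
have /cvg_series_cvg_0 : cvgn (series (fun _ : nat => nu set0 : R[i]^o)).
  by apply/cvg_ex; eexists; exact: nucvg.
move=> c0; apply: (cvg_unique (@norm_hausdorff _ R[i]^o) _ c0).
exact: cvg_cst.
Qed.

Lemma complex_measureU nu A B : complex_measure nu ->
  measurable A -> measurable B -> A `&` B = set0 ->
  nu (A `|` B) = nu A + nu B.
Proof.
move=> nuM mA mB AB0; rewrite -bigcup2E.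
have mAB i : measurable (bigcup2 A B i) by case: i => [|[|i]] //=; exact: measurable0.
have := nuM _ mAB; rewrite -trivIset_bigcup2 => /(_ AB0) nucvg.
apply: (cvg_unique (@norm_hausdorff _ R[i]^o) nucvg).
apply: cvg_near_cst; exists 2%N => // n /= n2.
rewrite (big_cat_nat _ n2) //= big_nat_recr //= big_nat1 /=.
rewrite big1_seq ?addr0 // => -[|[|i]]; rewrite mem_index_iota //= => _.
exact: complex_measure0.
Qed.

End additivity.

Section povm_facts.
Context {R : realType} {d : measure_display}.
Context {X : measurableType d} {H : hilbertType R}.
Implicit Types (mu : set X -> H -> H) (A B E : set X) (h k : H).

Lemma inner_inj h k : (forall l, inner l h = inner l k) -> h = k.
Proof. by move=> hk; apply: rdot_inj => l; rewrite /rdot hk. Qed.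

Lemma povmU mu A B h : povm mu -> measurable A -> measurable B ->
  A `&` B = set0 -> mu (A `|` B) h = mu A h + mu B h.
Proof.
move=> [_ _ muM] mA mB AB0; apply: inner_inj => l; rewrite innerDr.
exact: (complex_measureU (muM l h)).
Qed.

Lemma povmC mu A h : normalized_povm mu -> measurable A ->
  mu (~` A) h = h - mu A h.
Proof.
move=> [pmu mu1] mA; have := povmU h pmu mA (measurableC mA) (setICr A).
by rewrite setUCr mu1 => /= e; rewrite {2}e addrC addKr.
Qed.

Lemma povm_split mu A E h : povm mu -> measurable A -> measurable E ->
  mu E h = mu (E `&` A) h + mu (E `&` ~` A) h.
Proof.
move=> pmu mA mE; rewrite -povmU //; first by rewrite -setIUr setUCr setIT.
- exact: measurableI.
- by apply: measurableI => //; exact: measurableC.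
- by rewrite setIACA setICr setI0.
Qed.

End povm_facts.

Lemma rdot_sumr (R : realType) (H : hilbertType R) (I : Type) (r : seq I)
    (F : I -> H) (h : H) :
  '[h, \sum_(i <- r) F i] = \sum_(i <- r) '[h, F i].
Proof. exact: (big_morph _ (rdotDr h) (rdot0r h)). Qed.

(** * Spectral measures are C*-extreme *)

Section spectral_extreme.
Context {R : realType} {d : measure_display}.
Context {X : measurableType d} {H : hilbertType R}.
Implicit Types (mu nu : set X -> H -> H) (T U V S : H -> H) (E : set X).

Lemma unitaryI U V : bounded_op U -> bounded_op V ->
  (forall h k, '[h, U k] = '[V h, k]) ->
  (forall h, V (U h) = h) -> (forall h, U (V h) = h) -> 
  unitary_op U /\ adjoint U = V.
Proof.
move=> bU bV UV VU UV1; have Ua := adjoint_unique bU bV UV.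
by split => //; split => //; rewrite Ua; apply/funext.
Qed.

(** If mu(E) k = 0, then the nonnegative numbers '[T_j k, nu_j(E) T_j k] add up
    to 0, so that nu_j(E) annihilates T_j k. Taking k = h - mu(E) h for E, and
    k = mu(E) h for the complement of E, gives the intertwining relation. *)
Lemma spectral_intertwine mu n (nu : 'I_n -> set X -> H -> H)
    (T : 'I_n -> H -> H) i E h :
  spectral_measure mu -> (forall j, normalized_povm (nu j)) ->
  (forall j, bounded_op (T j)) ->
  (forall A, measurable A ->
    mu A = \sum_(j < n) (adjoint (T j) \o nu j A \o T j)) ->
  measurable E -> nu i E (T i h) = T i (mu E h).
Proof.
move=> [mu_n mu_proj] nu_n bT mu_sum mE.
have null A k : measurable A -> mu A k = 0 -> nu i A (T i k) = 0.
  move=> mA Ak0; have [[bnu pnu _] _] := nu_n i.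
  apply: positive_eq0; [exact: bnu | exact: pnu|].
  have := congr1 (fun v => '[k, v]) Ak0.
  rewrite rdot0r mu_sum // fct_sumE rdot_sumr /= => sum0.
  have ge0 j : 0 <= '[k, adjoint (T j) (nu j A (T j k))].
    have [bTa Ta] := adjointP (bT j); rewrite rdotC -Ta rdotC.
    by apply: positive_ge0; have [[_ + _] _] := nu_n j; apply.
  have [bTa Ta] := adjointP (bT i).
  have : '[k, adjoint (T i) (nu i A (T i k))] = 0.
    apply/eqP; move/eqP: sum0; rewrite psumr_eq0 // => /allP.
    by move/(_ i); rewrite mem_index_enum => /(_ isT) /implyP; apply.
  by rewrite rdotC -Ta rdotC.
have [[bnu _ _] _] := nu_n i; have [bmu _ idem] := mu_proj E mE.
have idemE k : mu E (mu E k) = mu E k by have := congr1 (@^~ k) idem.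
have := null E (h - mu E h) mE.
rewrite (bopB _ _ bmu) idemE subrr (bopB _ _ (bT i)) (bopB _ _ (bnu _ mE)).
move=> /(_ erefl)/eqP; rewrite subr_eq0 => /eqP ->.
have := null (~` E) (mu E h) (measurableC mE).
rewrite !povmC // idemE subrr => /(_ erefl)/eqP.
by rewrite subr_eq0 => /eqP.
Qed.

(** If T is invertible and intertwines the self-adjoint families mu and nu, then
    T* T commutes with mu, and so does |T|. Hence the unitary |T| T^-1
    intertwines nu and mu. *)
Lemma intertwine_unitary mu nu T : normalized_povm mu -> normalized_povm nu ->
  bounded_op T -> invertible_op T ->
  (forall E h, measurable E -> nu E (T h) = T (mu E h)) ->
  exists U, unitary_op U /\
    forall E, measurable E -> nu E = adjoint U \o mu E \o U.
Proof.
move=> [[bmu pmu _] _] [[bnu pnu _] _] bT [S [bS /funeqP ST /funeqP TS]] nuT.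
have {}ST h : S (T h) = h := ST h.
have {}TS h : T (S h) = h := TS h.
have [bTa Ta] := adjointP bT; have [bSa Sa] := adjointP bS.
have STa h : adjoint S (adjoint T h) = h.
  by apply: rdot_inj => k; rewrite rdotC -Sa -Ta TS rdotC.
have TSa h : adjoint T (adjoint S h) = h.
  by apply: rdot_inj => k; rewrite rdotC -Ta -Sa ST rdotC.
pose A h := adjoint T (T h).
have bA : bounded_op A := bop_comp bTa bT.
have pA : positive_op A.
  apply: positiveI => // [h k|h]; first by rewrite rdotC -!Ta rdotC.
  by rewrite rdotC -Ta rdot_ge0.
have muA E : measurable E -> commute_op (mu E) A.
  move=> mE h; apply: rdot_inj => k.
  rewrite (positive_sym (bmu _ mE) (pmu _ mE)).
  rewrite rdotC -Ta -nuT // (positive_sym (bnu _ mE) (pnu _ mE)).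
  by rewrite nuT // [RHS]rdotC -Ta.
have [M [bM pM MM MC]] := positive_sqrt bA pA.
have sM := positive_sym bM pM.
have MA h : M (A h) = A (M h) by rewrite -!MM.
pose U h := M (S h); pose V h := adjoint S (M h).
have bU : bounded_op U := bop_comp bM bS.
have bV : bounded_op V := bop_comp bSa bM.
have VmuU E h : measurable E -> V (mu E (U h)) = nu E h.
  by move=> mE; rewrite /V /U -(MC _ (bmu _ mE) (muA _ mE)) MM muA // -/A STa -nuT // TS.
have [|||uU aU] := unitaryI bU bV.
- by move=> h k; rewrite sM Sa.
- by move=> h; rewrite /V /U MM STa TS.
- move=> h; rewrite /U /V.
  have AM k : A (S (adjoint S k)) = k by rewrite /A TS TSa.
  have -> : S (adjoint S (M h)) = M (S (adjoint S h)).
    by rewrite -{1}[h]AM MA /A STa ST.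
  by rewrite MM AM.
exists U; split => // E mE; rewrite aU; apply/funext => h /=.
by rewrite VmuU.
Qed.

Lemma spectral_Cstar_extreme mu : spectral_measure mu -> Cstar_extreme mu.
Proof.
move=> smu; split; first exact: smu.1.
move=> n nu T nu_n bT T1 mu_sum.
suff /choice[U UP] : forall i, exists U, unitary_op U /\
  forall A, measurable A -> nu i A = adjoint U \o mu A \o U by exists U.
move=> i.
have [bTi iTi] := bT i.
apply: (intertwine_unitary smu.1 (nu_n i) bTi iTi) => E h mE.
by apply: (spectral_intertwine i h smu nu_n _ mu_sum mE) => j; have [] := bT j.
Qed.

End spectral_extreme.

(** * Eigenvalues forced by C*-extremality *)

Section reweighting.
Context {R : realType} {d : measure_display}.
Context {X : measurableType d} {H : hilbertType R}.
Implicit Types (mu : set X -> H -> H) (A B E : set X) (h k v w : H).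
Implicit Types (L M Q T : H -> H).

Lemma complex_measureD (nu1 nu2 : set X -> R[i]) :
  complex_measure nu1 -> complex_measure nu2 ->
  complex_measure (fun E => nu1 E + nu2 E).
Proof.
move=> m1 m2 F mF tF; under eq_cvg do rewrite big_split /=.
exact: (@cvgD _ R[i]^o _ _ _ _ _ _ _ (m1 _ mF tF) (m2 _ mF tF)).
Qed.

Lemma complex_measureI (nu : set X -> R[i]) A :
  complex_measure nu -> measurable A ->
  complex_measure (fun E => nu (E `&` A)).
Proof.
move=> m mA F mF tF; rewrite setI_bigcupl.
by apply: m => [i|]; [exact: measurableI | exact: trivIset_setIr].
Qed.

Lemma positive_add L M : positive_op L -> positive_op M ->
  positive_op (fun h => L h + M h).
Proof. by move=> pL pM h; rewrite innerDr addr_ge0. Qed.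

Lemma positive_scale (a : R) L : 0 <= a -> positive_op L ->
  positive_op (fun h => a%:C *: L h).
Proof. by move=> a0 pL h; rewrite innerZr mulr_ge0 // ler0c. Qed.

Lemma coercive_positive T (c : R) : bounded_op T -> symmetric_op T ->
  0 < c -> coercive c T -> positive_op T.
Proof.
move=> bT sT c0 cT; apply: positiveI => // h.
by apply: le_trans (cT h); rewrite mulr_ge0 ?rdot_ge0 ?ltW.
Qed.

Definition reweight mu A L M E h := L (mu (E `&` A) h) + M (mu (E `&` ~` A) h).

Lemma bop_reweight mu A L M E : povm mu -> measurable A -> measurable E ->
  bounded_op L -> bounded_op M -> bounded_op (reweight mu A L M E).
Proof.
move=> [bmu _ _] mA mE bL bM; apply: bop_add; apply: bop_comp => //; apply: bmu.
  exact: measurableI.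
by apply: measurableI => //; exact: measurableC.
Qed.

Definition commutant mu L := forall E, measurable E -> commute_op (mu E) L.

Lemma positive_reweight mu A L M E : povm mu -> measurable A -> measurable E ->
  bounded_op L -> positive_op L -> commutant mu L ->
  bounded_op M -> positive_op M -> commutant mu M ->
  positive_op (reweight mu A L M E).
Proof.
move=> [bmu pmu _] mA mE bL pL cL bM pM cM.
have mEA : measurable (E `&` A) by exact: measurableI.
have mEC : measurable (E `&` ~` A).
  by apply: measurableI => //; exact: measurableC.
apply: positive_add; apply: positive_comp => //.
- exact: bmu.
- exact: pmu.
- exact: cL.
- exact: bmu.
- exact: pmu.
- exact: cM.
Qed.

(** Weighting the two parts of mu by operators L and M from its commutant gives
    another POVM, with total mass L mu(A) + M mu(~A); conjugating by the inverse
    square root of that mass normalizes it. *)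
Lemma normalized_reweight mu A L M T Q : povm mu -> measurable A ->
  bounded_op L -> positive_op L -> commutant mu L ->
  bounded_op M -> positive_op M -> commutant mu M ->
  bounded_op Q -> symmetric_op Q ->
  (forall h, T (T h) = L (mu A h) + M (mu (~` A) h)) ->
  (forall h, T (Q h) = h) -> (forall h, Q (T h) = h) ->
  normalized_povm (fun E h => Q (reweight mu A L M E (Q h))).
Proof.
move=> pmu mA bL pL cL bM pM cM bQ sQ TT TQ QT; split; last first.
  by apply/funext => h; rewrite /reweight !setTI -TT TQ QT.
have bW E : measurable E -> bounded_op (reweight mu A L M E).
  by move=> mE; exact: bop_reweight.
split => [E mE|E mE h|h k].
- apply: (bop_comp (T := Q)) => //.
  by apply: (bop_comp (T := reweight mu A L M E)) => //; exact: bW.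
- rewrite (inner_adjoint bQ bQ sQ).
  by have := positive_reweight pmu mA mE bL pL cL bM pM cM; apply.
have [_ _ mmu] := pmu.
have -> : (fun E => inner h (Q (reweight mu A L M E (Q k)))) =
   (fun E => inner (L (Q h)) (mu (E `&` A) (Q k)) +
             inner (M (Q h)) (mu (E `&` ~` A) (Q k))).
  apply/funext => E; rewrite (inner_adjoint bQ bQ sQ) innerDr.
  by rewrite (inner_adjoint bL bL (positive_sym bL pL))
             (inner_adjoint bM bM (positive_sym bM pM)).
apply: complex_measureD.
  exact: (complex_measureI (nu := fun E => inner _ (mu E _)) (mmu _ _) mA).
apply: (complex_measureI (nu := fun E => inner _ (mu E _)) (mmu _ _)).
exact: measurableC.
Qed.

(** Splitting mu into its reweightings by (a L, a M) and (1 - a L, 1 - a M), for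
    a small constant a, is an admissible decomposition. The value at A of
    the first component is similar to (L mu(A) + M mu(~A))^-1 L mu(A), so
    C*-extremality makes every eigenvalue of that operator an eigenvalue
    of mu(A). *)
Lemma Cstar_extreme_eigenvalue mu A L M (c y : R) v :
  Cstar_extreme mu -> measurable A ->
  bounded_op L -> positive_op L -> commutant mu L ->
  bounded_op M -> positive_op M -> commutant mu M ->
  0 < c -> coercive c (fun h => L (mu A h) + M (mu (~` A) h)) ->
  v != 0 -> L (mu A v) = y%:C *: (L (mu A v) + M (mu (~` A) v)) ->
  exists2 w, w != 0 & mu A w = y%:C *: w.
Proof.
move=> [nmu ext] mA bL pL cL bM pM cM c0.
set D := (fun h => _) => cD v0 Lv.
have pmu := nmu.1; have [bmu pmu' mmu] := pmu; have mCA := measurableC mA.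
have bD : bounded_op D.
  by apply: bop_add; apply: bop_comp => //; apply: bmu.
have [nL nL0 Ln] := rdot_op_bound bL; have [nM nM0 Mn] := rdot_op_bound bM.
have [nD nD0 Dn] := rdot_op_bound bD.
(* This makes a L, a M and a D at most 1 / 2. *)
pose a := (2 * (nL + nM + nD))^-1.
have a0 : 0 < a by rewrite invr_gt0; lra.
have an : a * (nL + nM + nD) = 2^-1 by rewrite /a; field; lra.
have half T n : 0 < n -> n <= nL + nM + nD ->
    (forall h, '[h, T h] <= n * '[h, h]) ->
    coercive 2^-1 (fun h => h - a%:C *: T h).
  move=> n0 nle Tn h; rewrite !rdotE.
  have := ler_wpM2l (ltW a0) (Tn h).
  have := ler_wpM2r (rdot_ge0 h) (ler_wpM2l (ltW a0) nle); rewrite an.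
  lra.
have bC T : bounded_op T -> bounded_op (fun h => h - a%:C *: T h).
  by move=> bT; apply: bop_sub; [exact: bop_id | exact: bop_scale].
have pC T n : bounded_op T -> positive_op T -> 0 < n -> n <= nL + nM + nD ->
    (forall h, '[h, T h] <= n * '[h, h]) ->
    positive_op (fun h => h - a%:C *: T h).
  move=> bT pT n0 nle Tn; apply: (@coercive_positive _ 2^-1) => //.
  - exact: bC.
  - by move=> h k; rewrite !rdotE (positive_sym bT pT).
  - exact: half nle Tn.
have cC T : commutant mu T -> commutant mu (fun h => h - a%:C *: T h).
  by move=> cT E mE h; rewrite (bopB _ _ (bmu _ mE)) (bopZ _ _ (bmu _ mE)) cT.
pose Lf (i : 'I_2) := if i == ord0 then fun h => a%:C *: L h
                      else fun h => h - a%:C *: L h.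
pose Mf (i : 'I_2) := if i == ord0 then fun h => a%:C *: M h
                      else fun h => h - a%:C *: M h.
have bLf i : bounded_op (Lf i).
  by rewrite /Lf; case: ifP => _; [exact: bop_scale | exact: bC].
have bMf i : bounded_op (Mf i).
  by rewrite /Mf; case: ifP => _; [exact: bop_scale | exact: bC].
have pLf i : positive_op (Lf i).
  rewrite /Lf; case: ifP => _; first by apply: positive_scale => //; exact: ltW.
  apply: (pC L nL) => //; lra.
have pMf i : positive_op (Mf i).
  rewrite /Mf; case: ifP => _; first by apply: positive_scale => //; exact: ltW.
  apply: (pC M nM) => //; lra.
have cLf i : commutant mu (Lf i).
  rewrite /Lf; case: ifP => _; last exact: cC.
  by move=> E mE h; rewrite (bopZ _ _ (bmu _ mE)) cL.
have cMf i : commutant mu (Mf i).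
  rewrite /Mf; case: ifP => _; last exact: cC.
  by move=> E mE h; rewrite (bopZ _ _ (bmu _ mE)) cM.
have cDf i : exists2 e, 0 < e &
    coercive e (fun h => Lf i (mu A h) + Mf i (mu (~` A) h)).
  rewrite /Lf /Mf; case: ifP => _.
    exists (a * c) => [|h]; first exact: mulr_gt0.
    by rewrite -scalerDr rdotZr -mulrA ler_pM2l // cD.
  exists 2^-1 => [|h]; first by rewrite invr_gt0.
  have := @half D nD nD0 _ Dn h; rewrite /D => /(_ _)/le_trans -> //; first lra.
  rewrite (povmC _ nmu mA) !rdotE; lra.
have [T [Q TQP]] : exists T Q : 'I_2 -> H -> H, forall i,
    [/\ bounded_op (T i) /\ bounded_op (Q i),
        symmetric_op (T i) /\ symmetric_op (Q i),
        forall h, T i (T i h) = Lf i (mu A h) + Mf i (mu (~` A) h),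
        forall h, T i (Q i h) = h & forall h, Q i (T i h) = h].
  suff /choice[T /choice[Q TQP]] : forall i, exists T Q, [/\
      bounded_op T /\ bounded_op Q, symmetric_op T /\ symmetric_op Q,
      forall h, T (T h) = Lf i (mu A h) + Mf i (mu (~` A) h),
      forall h, T (Q h) = h & forall h, Q (T h) = h] by exists T, Q.
  move=> i; have [e e0 ce] := cDf i.
  have [||T [Q [bTQ sTQ TT [TQ QT] _]]] := coercive_sqrt _ _ e0 ce.
  - by apply: bop_add; apply: bop_comp => //; apply: bmu.
  - have := positive_reweight pmu mA measurableT (bLf i) (pLf i) (cLf i)
      (bMf i) (pMf i) (cMf i).
    by rewrite /reweight !setTI.
  by exists T, Q.
pose nu i E h := Q i (reweight mu A (Lf i) (Mf i) E (Q i h)).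
have aT i : adjoint (T i) = T i.
  by have [[bT _] [sT _] _ _ _] := TQP i; apply: adjoint_unique.
have [||||U UP] := ext 2 nu T.
- move=> i; have [[bT bQ] [sT sQ] TT TQ' QT] := TQP i.
  exact: (normalized_reweight (T := T i)).
- move=> i; have [[bT bQ] _ _ TQ' QT] := TQP i; split => //.
  by exists (Q i); split => //; apply/funext.
- apply/funext => h; rewrite fct_sumE !big_ord_recl big_ord0 addr0 /= !aT.
  have [_ _ TT0 _ _] := TQP ord0; have [_ _ TT1 _ _] := TQP (lift ord0 ord0).
  rewrite TT0 TT1 /Lf /Mf /= !(povmC _ nmu mA); vector_ring.
- move=> E mE; apply/funext => h; rewrite fct_sumE !big_ord_recl big_ord0 addr0.
  rewrite /= !aT /nu.
  have [_ _ _ TQ0 QT0] := TQP ord0; have [_ _ _ TQ1 QT1] := TQP (lift ord0 ord0).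
  rewrite TQ0 TQ1 QT0 QT1 (povm_split h pmu mA mE) /reweight /Lf /Mf /=.
  vector_ring.
have [[bU UaU UUa] nuU] := UP ord0.
have [[bT bQ] _ TT TQ' QT] := TQP ord0.
have [bUa _] := adjointP bU.
have UUaE h : U ord0 (adjoint (U ord0) h) = h := congr1 (@^~ h) UUa.
have UaUE h : adjoint (U ord0) (U ord0 h) = h := congr1 (@^~ h) UaU.
exists (U ord0 (T ord0 v)).
  apply: contra v0 => /eqP Uv0; apply/eqP.
  rewrite -[v]QT -[T ord0 v]UaUE Uv0 (bop0 bUa); exact: bop0.
have -> : mu A (U ord0 (T ord0 v)) = U ord0 (nu ord0 A (T ord0 v)).
  by rewrite nuU //= UUaE.
have mu0 h : mu set0 h = 0.
  apply: inner_inj => l; rewrite (complex_measure0 (mmu l h)).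
  by rewrite -(bop0 bL) (inner_adjoint bL bL (positive_sym bL pL)) /inner linear0l.
rewrite /nu QT /reweight setIid setICr mu0 (bop0 (bMf _)) addr0.
rewrite -(bopZ _ _ bU) -(bopZ _ _ bT) [Lf _ _]/=; congr (U _ _).
rewrite -[RHS]QT TT /Lf /Mf /=; congr (Q _ _).
rewrite (bopZ _ _ (bmu _ mA)) (bopZ _ _ (bmu _ mCA)) (bopZ _ _ bL) (bopZ _ _ bM).
by rewrite -!scalerDr -Lv.
Qed.

End reweighting.

Section eigenvalues.
Context {R : realType} {d : measure_display}.
Context {X : measurableType d} {H : hilbertType R}.
Implicit Types (mu : set X -> H -> H) (A E : set X) (h k v w : H).

(** Put K = B (1 - B) for B = mu(A), which is positive and nonzero, choose a small
    t > 0 and let P and N be twice the positive and negative parts of t - K.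
    Since K is not bounded by t, the operator N is nonzero, and P N = 0.
    With L = y (1 - B) + s P ^ 2 and M = (1 - y) B + s P ^ 2 the total mass
    L B + M (1 - B) = K + s P ^ 2 is bounded below, whereas on the range of N it
    equals K and L B equals y K. So y is an eigenvalue of
    (L B + M (1 - B))^-1 L B, for every y between 0 and 1. *)
Lemma Cstar_extreme_all_eigenvalues mu A (y : R) h0 :
  Cstar_extreme mu -> commutative_povm mu -> measurable A ->
  mu A (mu A h0) != mu A h0 -> 0 < y < 1 ->
  exists2 w, w != 0 & mu A w = y%:C *: w.
Proof.
move=> ext comm mA h0P /andP[y0 y1].
have nmu := ext.1; have pmu := nmu.1; have [bmu pmu' _] := pmu.
have mCA := measurableC mA.
pose B := mu A; pose B' := mu (~` A).
have bB : bounded_op B := bmu _ mA; have bB' : bounded_op B' := bmu _ mCA.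
have pB : positive_op B := pmu' _ mA; have pB' : positive_op B' := pmu' _ mCA.
have B'E h : B' h = h - B h by exact: povmC.
have commE E F h : measurable E -> measurable F -> mu E (mu F h) = mu F (mu E h).
  by move=> mE mF; exact: (congr1 (@^~ h) (comm E F mE mF)).
pose K h := B (B' h).
have bK : bounded_op K := bop_comp bB bB'.
have pK : positive_op K by apply: positive_comp => // h; exact: commE.
have cK : commutant mu K.
  by move=> E mE h; rewrite /K /B /B' commE // [in LHS](commE E).
have Kh0 : 0 < '[h0, K h0].
  rewrite lt0r positive_ge0 // andbT; apply: contra h0P => /eqP.
  move=> /(positive_eq0 bK pK); rewrite /K B'E (bopB _ _ bB) => /eqP.
  by rewrite subr_eq0 eq_sym.
have h0n : 0 < '[h0, h0].
  by apply: rdot_gt0; apply: contraTneq Kh0 => ->; rewrite rdot0l ltxx.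
(* t is half the Rayleigh quotient of K at h0, so K <= t fails at h0. *)
pose t := '[h0, K h0] / (2 * '[h0, h0]).
have t0 : 0 < t by rewrite divr_gt0 // mulr_gt0.
have th0 : t * '[h0, h0] = '[h0, K h0] / 2 by rewrite /t; field; rewrite gt_eqF.
pose C h := t%:C *: h - K h.
have bC : bounded_op C by apply: bop_sub => //; apply: bop_scale; exact: bop_id.
have sC : symmetric_op C by move=> h k; rewrite !rdotE (positive_sym bK pK).
have cC : commutant mu C.
  by move=> E mE h; rewrite (bopB _ _ (bmu _ mE)) (bopZ _ _ (bmu _ mE)) cK.
have CE h : C h = t%:C *: h - K h by [].
clearbody C.
have bC2 : bounded_op (fun h => C (C h)) by exact: bop_comp.
have pC2 : positive_op (fun h => C (C h)).
  apply: positiveI => // [h k|h]; first by rewrite !sC.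
  by rewrite sC rdot_ge0.
have [M [bM pM MM MC2]] := positive_sqrt bC2 pC2.
have MC : commute_op C M by apply: MC2.
have cM : commutant mu M.
  by move=> E mE; apply: MC2 => [|h]; [exact: bmu | rewrite !cC].
pose P h := M h + C h; pose N h := M h - C h.
have bP : bounded_op P by exact: bop_add.
have bN : bounded_op N by exact: bop_sub.
have sP : symmetric_op P.
  by move=> h k; rewrite rdotDr rdotDl sC (positive_sym bM pM).
have cP : commutant mu P.
  by move=> E mE h; rewrite (bopD _ _ (bmu _ mE)) cM // cC.
have PN h : P (N h) = 0.
  rewrite /P /N (bopB _ _ bM) (bopB _ _ bC) MM MC.
  by rewrite addrA subrK subrr.
have PE h : P h = M h + C h by [].
have NE h : N h = M h - C h by [].
clearbody P N.
have [w Nw] : exists w, N w != 0.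
  apply: contrapT => N0; have {}N0 h : N h = 0.
    by apply: contrapT => /eqP Nh; apply: N0; exists h.
  have : '[h0, N h0] = 0 by rewrite N0 rdot0r.
  rewrite NE CE !rdotE th0; have := positive_ge0 h0 pM; lra.
pose s := (2 * t)^-1.
have s0 : 0 < s by rewrite invr_gt0 mulr_gt0.
have bP2 : bounded_op (fun h => P (P h)) by exact: bop_comp.
have pP2 : positive_op (fun h => s%:C *: P (P h)).
  apply: positive_scale; first exact: ltW.
  by apply: positiveI => // [h k|h]; [rewrite !sP | rewrite sP rdot_ge0].
pose Lw h := y%:C *: B' h + s%:C *: P (P h).
pose Mw h := (1 - y)%:C *: B h + s%:C *: P (P h).
have DE h : Lw (B h) + Mw (B' h) = K h + s%:C *: P (P h).
  have -> : P (P h) = P (P (B h)) + P (P (B' h)).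
    by rewrite -!(bopD _ _ bP) B'E addrC subrK.
  rewrite /Lw /Mw -[B (B' h)]/(K h).
  have -> : B' (B h) = K h by rewrite /K; exact: commE.
  vector_ring.
apply: (@Cstar_extreme_eigenvalue _ _ _ _ mu A Lw Mw (t / 2) y (N w)) => //.
- by apply: bop_add; exact: bop_scale.
- by apply: positive_add => //; apply: positive_scale => //; exact: ltW.
- move=> E mE h; have bE := bmu _ mE.
  by rewrite (bopD _ _ bE) !(bopZ _ _ bE) !cP // [mu E (B' h)]commE.
- by apply: bop_add; exact: bop_scale.
- by apply: positive_add => //; apply: positive_scale => //; lra.
- move=> E mE h; have bE := bmu _ mE.
  by rewrite (bopD _ _ bE) !(bopZ _ _ bE) !cP // [mu E (B h)]commE.
- by rewrite divr_gt0.
- move=> h; rewrite DE.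
  (* As K = t - P + M, it remains to see that s P ^ 2 - P + t / 2 is positive:
     it is s (P - t) ^ 2. *)
  have -> : K h = t%:C *: h - P h + M h by rewrite PE CE; vector_ring.
  rewrite !rdotE (sP h (P h)).
  have := rdot_ge0 (P h - t%:C *: h); rewrite !rdotE (rdotC (P h) h) => sq.
  have := mulr_ge0 (ltW s0) sq.
  have := positive_ge0 h pM.
  have st : s * t = 2^-1 by rewrite /s; field; rewrite gt_eqF.
  have := congr1 ( *%R^~ '[h, P h]) st.
  have := congr1 ( *%R^~ (t * '[h, h])) st => /=.
  lra.
- rewrite -/(B (N w)) -/(B' (N w)) DE PN (bop0 bP) scaler0 addr0 /Lw.
  have PB h : P (B h) = B (P h) by rewrite /B cP.
  rewrite !PB PN (bop0 bP) (bop0 bB) scaler0 addr0.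
  by congr (_ *: _); rewrite /K; exact: commE.
Qed.

(** Unit eigenvectors of a symmetric operator for distinct eigenvalues are at
    distance sqrt 2, so a countable dense set meets disjoint balls around them. *)
Lemma separable_eigenvalues (B : H -> H) : separable H -> symmetric_op B ->
  (forall y : R, 0 < y < 1 -> exists2 w, w != 0 & B w = y%:C *: w) -> False.
Proof.
move=> [D [Dc Dd]] sB Beig.
have /choice[e eP] : forall y : R, exists w, 0 < y < 1 ->
    '[w, w] = 1 /\ forall k, '[B w, k] = y * '[w, k].
  move=> y; have [y01|_] := boolP (0 < y < 1); last by exists 0.
  have [w w0 Bw] := Beig y y01; exists ((rnorm w)^-1%:C *: w) => _.
  have r0 : rnorm w != 0 by apply: contra w0 => /eqP/rnorm0_eq0->.
  split=> [|k]; first by rewrite !rdotE rdot_normE; field.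
  by rewrite -sB !rdotE sB Bw !rdotE; ring.
have dist y z : 0 < y < 1 -> 0 < z < 1 -> y != z -> rnorm (e y - e z) ^+ 2 = 2.
  move=> /eP[ey Ey] /eP[ez Ez] yz; rewrite -rdot_normE !rdotE ey ez.
  have : '[e y, e z] = 0.
    apply/eqP; have : (y - z) * '[e y, e z] = 0.
      by rewrite mulrBl -Ey -sB [in X in _ - X]rdotC -Ez rdotC subrr.
    by move/eqP; rewrite mulf_eq0 subr_eq0 (negbTE yz).
  by rewrite (rdotC (e z)) => ->; ring.
have /choice[g gP] : forall y : R, exists v, D v /\ rnorm (e y - v) < 2^-1.
  move=> y; have [||v [yv Dv]] := Dd (ball (e y) (2^-1%:C : R[i])).
  - by exists (e y); apply: ballxx; rewrite ltcR invr_gt0.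
  - exact: ball_open.
  by exists v; split=> //; move: yv; rewrite -ball_normE /ball_ /= normE ltcR.
have ginj : {in `]0, 1[%classic &, injective g}.
  move=> y z; rewrite !inE /= !in_itv /= => y01 z01 gyz.
  apply: contrapT => /eqP yz; have := dist _ _ y01 z01 yz.
  have := rnormD (e y - g y) (g z - e z); rewrite gyz addrA subrK.
  have [_ ] := gP y; have [_] := gP z; rewrite gyz (rnormB (g z)).
  have := rnorm_ge0 (e y - e z); nra.
have /countable_lebesgue_measure0 : countable (`]0, 1[%classic : set R).
  have /countable_injP[f finj] := Dc.
  apply/countable_injP; exists (f \o g) => y z y01 z01 /= fg.
  by apply: ginj => //; apply: finj; rewrite ?inE //; [have [] := gP y | have [] := gP z].
rewrite lebesgue_measure_itv /= lte_fin ltr01 sube0 => /eqP.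
by rewrite eqe oner_eq0.
Qed.

End eigenvalues.

Lemma Cstar_extreme_spectral (R : realType) (d : measure_display)
    (X : measurableType d) (H : hilbertType R) (mu : set X -> H -> H) :
  separable H -> commutative_povm mu -> Cstar_extreme mu -> spectral_measure mu.
Proof.
move=> sepH comm ext; split=> [|A mA]; first exact: ext.1.
have [[bmu pmu _] _] := ext.1; have bA := bmu _ mA.
have sA := positive_sym bA (pmu _ mA).
split => //; first exact: adjoint_unique.
apply/funext => h /=; apply: contrapT => /eqP AAh.
apply: (separable_eigenvalues sepH sA) => y y01.
exact: Cstar_extreme_all_eigenvalues AAh y01.
Qed.

Theorem theorem3p9 (R : realType) (d : measure_display)
    (X : measurableType d) (H : hilbertType R) (mu : set X -> H -> H)
    (X_nonempty : [set: X] !=set0)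
    (X_singletons : forall x : X, measurable [set x])
    (H_separable : separable H)
    (mu_povm : normalized_povm mu)
    (mu_comm : commutative_povm mu) :
  Cstar_extreme mu <-> spectral_measure mu.
Proof.
split; first exact: Cstar_extreme_spectral.
exact: spectral_Cstar_extreme.
Qed.
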